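(* Let $S$ be a Seidel matrix of order $n$ whose smallest eigenvalue is $-5$. If $\omega([S])=4$ and $\alpha([S])\leqslant28$, then $n\leqslant276$.
   Context: All graphs are finite, simple, undirected. A Seidel matrix of order $n$ is a real symmetric $n\times n$ matrix with zero diagonal and off-diagonal entries in $\{\pm1\}$; its graph $G(S)$ has vertex set $\{1,\dots,n\}$ with $i\sim j$ iff $S_{ij}=-1$. The switching graph $\mathcal{Sw}(S)$ is the graph $G(S')$ of the Seidel matrix $S'=\begin{pmatrix}S&-S+\mathbf{I}\\-S+\mathbf{I}&S\end{pmatrix}$ of order $2n$. Define $\alpha([S]):=\alpha(\mathcal{Sw}(S))$ (independence number) and $\omega([S]):=\omega(\mathcal{Sw}(S))$ (clique number). *)

(* Defs.v *)
From mathcomp Require Import all_boot all_order all_algebra.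
From mathcomp Require Import reals.

Set Implicit Arguments.
Unset Strict Implicit.
Unset Printing Implicit Defensive.

Import Order.TTheory GRing.Theory Num.Theory.
Local Open Scope ring_scope.

(* A finite graph is given by its adjacency relation on a finType. *)
Section Graph.
Variables (T : finType) (e : rel T).

Definition is_clique (A : {set T}) : bool :=
  [forall x in A, forall y in A, (x != y) ==> e x y].

Definition is_independent (A : {set T}) : bool :=
  [forall x in A, forall y in A, (x != y) ==> ~~ e x y].

Definition clique_number : nat :=
  (\max_(A : {set T} | is_clique A) #|A|)%N.

Definition independence_number : nat :=
  (\max_(A : {set T} | is_independent A) #|A|)%N.

End Graph.

Section Seidel.
Variables (R : realType) (n : nat).

Definition is_seidel (S : 'M[R]_n) : Prop :=
  [/\ S^T = S,
      forall i, S i i = 0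
    & forall i j, i != j -> S i j = 1 \/ S i j = -1].

Definition seidel_graph (S : 'M[R]_n) : rel 'I_n := fun i j => S i j == -1.

Definition is_smallest_eigenvalue (A : 'M[R]_n) (a : R) : Prop :=
  eigenvalue A a /\ forall b : R, eigenvalue A b -> a <= b.

End Seidel.

Section Switching.
Variables (R : realType) (n : nat) (S : 'M[R]_n).

Definition switching_seidel : 'M[R]_(n + n) :=
  block_mx S (- S + 1%:M) (- S + 1%:M) S.

Definition switching_graph : rel 'I_(n + n) := seidel_graph switching_seidel.

Definition switching_alpha : nat := independence_number switching_graph.

Definition switching_omega : nat := clique_number switching_graph.

End Switching.

(* Main.v *)
(** Write the lines of S as vectors of Gram matrix 5I + S. For two lines i, j,
   the lines w forming a negative triple with them can be signed so as to have
   inner product -1 with both; on this "link" let two lines be adjacent when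
   their inner product is -1. A link is triangle-free (omega = 4), its
   independent sets have at most 27 elements (alpha <= 28), and projecting away
   from i and j shows that 2I + J/4 - A is positive semidefinite for its
   adjacency matrix A. Each further line is in one or three of the links of
   {i,j}, {i,w}, {j,w}, so n + 2 deg w is the sum of their sizes; if the link
   of i, j is the largest one and has m vertices and maximum degree c, then
   n + 2c <= 3m. It remains to show 3m <= 276 + 2c.

   Let p have degree c. If 3m >= 277 + 2c, discard vertices far from p until m
   is the least integer with this property. Sparse cases (c <= 6) contradict
   the independence bound. For 7 <= c <= 13 the test vector constant on N(p)
   and on the far vertices is already negative. For 14 <= c <= 22 it shows that
   few edges join far vertices; but averaging the same inequality over the
   neighbours of p forces many such edges. For c >= 23 no two far vertices are
   adjacent. *)

Require Import Defs.
From mathcomp Require Import all_boot all_order all_algebra.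
From mathcomp Require Import reals zify ring lra spectral complex.
From mathcomp Require sesquilinear.

Import Order.TTheory GRing.Theory Num.Theory.
Local Open Scope ring_scope.

Set Implicit Arguments.
Unset Strict Implicit.
Unset Printing Implicit Defensive.

(** * Triangle-free graphs *)

Section Independence.
Variables (V : finType) (e : rel V).
Hypotheses (e_sym : symmetric e) (e_irr : irreflexive e).
Hypothesis e_tf : forall x y z, e x y -> e y z -> e x z = false.

Definition indep (I : {set V}) := forall x y, x \in I -> y \in I -> ~~ e x y.

Definition nbrs (B : {set V}) x := [set y in B | e x y].

Lemma double_count_nbrs (A B : {set V}) :
  (\sum_(x in A) #|nbrs B x| = \sum_(y in B) #|nbrs A y|)%N.
Proof.
have h (C D : {set V}) x :
    #|nbrs D x| = (\sum_(y in D) e x y)%N.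
  rewrite -sum1_card big_mkcond [RHS]big_mkcond /=; apply: eq_bigr => y _.
  by rewrite inE; case: (y \in D); case: (e x y).
rewrite (eq_bigr _ (fun x _ => h A B x)) exchange_big /=.
apply: eq_bigr => y _; rewrite (h B A); apply: eq_bigr => x _.
by rewrite e_sym.
Qed.

(* A vertex outside [I] has a neighbour in [I]; at most one vertex has a given
   [i] in [I] as its only neighbour, since two could replace [i]. *)
Lemma max_indep_degree_sum (B I : {set V}) :
    I \subset B -> indep I ->
    (forall J : {set V}, J \subset B -> indep J -> #|J| <= #|I|)%N ->
  (2 * #|B| <= 3 * #|I| + \sum_(x in I) #|nbrs B x|)%N.
Proof.
move=> IB hI maxI.
have swap (y : V) : y \in B :\: I -> (0 < #|nbrs I y|)%N.
  rewrite inE => /andP[yI yB]; rewrite card_gt0; apply/negP => /eqP y0.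
  have y_far x : x \in I -> ~~ e y x.
    by move=> xI; apply/negP => eyx; have := in_set0 x; rewrite -y0 inE xI eyx.
  have yIB : y |: I \subset B.
    by apply/subsetP => x; rewrite !inE => /predU1P[->//|/(subsetP IB)].
  suff /(maxI _ yIB) : indep (y |: I) by rewrite cardsU1 yI add1n ltnn.
  move=> x z; rewrite !inE.
  case/predU1P=> [->|xI] /predU1P[->|zI]; first by rewrite e_irr.
  - exact: y_far.
  - by rewrite e_sym y_far.
  - exact: hI.
pose S1 := [set y in B :\: I | #|nbrs I y| == 1%N].
have S1_le : (#|S1| <= #|I|)%N.
  pose f (y : V) := odflt y [pick x in nbrs I y].
  have fP y : y \in S1 -> nbrs I y = [set f y].
    rewrite inE => /andP[_ /cards1P[x yx]]; rewrite yx /f.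
    by case: pickP => [z | /(_ x)]; rewrite yx inE ?eqxx // => /eqP->.
  rewrite -(card_in_imset (f := f) (D := mem S1)).
    apply/subset_leq_card/subsetP => _ /imsetP[y /fP yf ->].
    by have := set11 (f y); rewrite -yf inE => /andP[].
  move=> y z yS zS fyz; apply/eqP/negPn/negP => yz.
  have yf := fP y yS; have zf := fP z zS; rewrite -fyz in zf.
  have mem_f w x : nbrs I w = [set f y] -> x \in I -> e w x -> x = f y.
    by move=> wf xI ewx; apply/set1P; rewrite -wf inE xI.
  have [eyf fI] : e y (f y) /\ f y \in I.
    by have := set11 (f y); rewrite -{1}yf inE => /andP[].
  have ezf : e z (f y) by have := set11 (f y); rewrite -{1}zf inE => /andP[].
  have [/andP[yI yB] /andP[zI zB]] : (y \notin I) && (y \in B) /\ (z \notin I) && (z \in B).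
    by move: yS zS; rewrite !inE => /andP[-> _] /andP[-> _].
  have eyz : e y z = false by rewrite (@e_tf y (f y) z) // e_sym.
  suff /maxI h : y |: (z |: (I :\ f y)) \subset B.
    suff /h : indep (y |: (z |: (I :\ f y))).
      rewrite !cardsU1 !inE (negbTE yz) (negbTE yI) (negbTE zI) /=.
      by rewrite [X in (_ <= X)%N](cardsD1 (f y)) fI !andbF /= !add1n ltnn.
    move=> u v; rewrite !inE.
    case/or3P=> [/eqP->|/eqP->|/andP[uf uI]] /or3P[/eqP->|/eqP->|/andP[vf vI]];
      rewrite ?e_irr ?eyz //; try by rewrite e_sym eyz.
    - by apply: contra vf => /(mem_f _ _ yf vI)->.
    - by apply: contra vf => /(mem_f _ _ zf vI)->.
    - by rewrite e_sym; apply: contra uf => /(mem_f _ _ yf uI)->.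
    - by rewrite e_sym; apply: contra uf => /(mem_f _ _ zf uI)->.
    - exact: hI.
  apply/subsetP => x; rewrite !inE => /or3P[/eqP->|/eqP->|/andP[_ /(subsetP IB)]] //.
(* Outside [I], only the vertices of [S1] have fewer than two neighbours in [I], and these have
   exactly one. *)
have h2 : (2 * #|B :\: I| <= \sum_(y in B :\: I) #|nbrs I y| + #|S1|)%N.
  rewrite -sum1_card -[#|S1|]sum1_card big_distrr /=.
  have -> : (\sum_(y in S1) 1 = \sum_(y in B :\: I) (#|nbrs I y| == 1))%N.
    rewrite big_mkcond [RHS]big_mkcond; apply: eq_bigr => y _ /=.
    by rewrite !inE; case: (y \in I); case: (y \in B) => //=; case: (_ == _).
  by rewrite -big_split; apply: leq_sum => y /swap /=; case: #|_| => [|[|n]].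
have h3 : (\sum_(y in B :\: I) #|nbrs I y| <= \sum_(x in I) #|nbrs B x|)%N.
  rewrite double_count_nbrs; apply: leq_sum => x _; apply/subset_leq_card/subsetP => y.
  by rewrite !inE => /andP[/andP[_ ->] ->].
have := cardsID I B; rewrite (setIidPr IB); lia.
Qed.

Lemma indepP (I : {set V}) : reflect (indep I) (is_independent e I).
Proof.
apply: (iffP forallP) => [h x y xI yI | h x].
  case: (eqVneq x y) => [->|xy]; first by rewrite e_irr.
  by have := implyP (h x) xI => /forallP/(_ y)/implyP/(_ yI); rewrite xy.
apply/implyP => xI; apply/forallP => y; apply/implyP => yI.
by apply/implyP => _; apply: h.
Qed.

Lemma max_indep_exists (B : {set V}) : exists I : {set V},
  [/\ I \subset B, indep I
    & forall J : {set V}, J \subset B -> indep J -> (#|J| <= #|I|)%N].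
Proof.
pose P (I : {set V}) := (I \subset B) && is_independent e I.
have P0 : P set0.
  by rewrite /P sub0set; apply/indepP => x y; rewrite inE.
case: (@arg_maxnP _ set0 P (fun I => #|I|) P0) => I /andP[IB /indepP hI] maxI.
exists I; split=> // J JB /indepP hJ; apply: maxI; exact/andP.
Qed.

Lemma card_nbrs_split (B I : {set V}) x : I \subset B ->
  #|nbrs B x| = (#|nbrs I x| + #|nbrs (B :\: I) x|)%N.
Proof.
move=> IB; rewrite -(cardsID I (nbrs B x)); congr addn; apply: eq_card => y.
  by rewrite !inE; case yI: (y \in I); rewrite ?andbF // andbT (subsetP IB).
by rewrite !inE andbA.
Qed.

(** Every edge meeting the independent set [I] has exactly one end in [I], so these edges contribute
    twice the degree sum over [I]. *)
Lemma degree_sum_split (B I : {set V}) : I \subset B -> indep I ->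
  (\sum_(x in B) #|nbrs B x| =
   2 * (\sum_(x in I) #|nbrs B x|) + \sum_(x in B :\: I) #|nbrs (B :\: I) x|)%N.
Proof.
move=> IB hI; have nbrI x : x \in I -> #|nbrs (B :\: I) x| = #|nbrs B x|.
  move=> xI; rewrite (card_nbrs_split x IB) (_ : nbrs I x = set0) ?cards0 //.
  apply/setP => y; rewrite !inE; apply/negP => /andP[yI exy].
  by have := hI x y xI yI; rewrite exy.
rewrite (big_setID I) /= (setIidPr IB).
rewrite [X in (_ + X)%N](eq_bigr (fun x => #|nbrs I x| + #|nbrs (B :\: I) x|)%N);
  last by move=> x _; apply: card_nbrs_split.
rewrite big_split /= -(double_count_nbrs I) (eq_bigr _ nbrI); lia.
Qed.

(** A maximum independent set [I] of [B] is removed, then a maximum one [J] of the rest. The two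
    bounds add up to [8 * #|B| - 10 * #|I| - 6 * #|J|], whence the constant 16. *)
Lemma degree_sum_lower (B : {set V}) (k : nat) :
    (forall J : {set V}, J \subset B -> indep J -> #|J| <= k)%N ->
  (8 * #|B| <= \sum_(x in B) #|nbrs B x| + 16 * k)%N.
Proof.
move=> hk.
have [I [IB hI maxI]] := max_indep_exists B.
have [J [JB hJ maxJ]] := max_indep_exists (B :\: I).
have sI := max_indep_degree_sum IB hI maxI.
have sJ := max_indep_degree_sum JB hJ maxJ.
have Ik := hk I IB hI.
have Jk := hk J (subset_trans JB (subsetDl _ _)) hJ.
have cardD : (#|B :\: I| + #|I| = #|B|)%N.
  by rewrite addnC -[in RHS](cardsID I B) (setIidPr IB).
rewrite (degree_sum_split IB hI) (degree_sum_split JB hJ).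
lia.
Qed.

End Independence.

(** * Triangle-free graphs with 2I + J/4 - A positive semidefinite *)

Section TriangleFreeGraph.

Variables (R : realFieldType) (V : finType) (e : rel V).
Hypotheses (e_sym : symmetric e) (e_irr : irreflexive e).
Hypothesis e_tf : forall x y z, e x y -> e y z -> e x z = false.
Hypothesis psd : forall v : V -> R,
  0 <= 2 * \sum_x v x ^+ 2 + (\sum_x v x) ^+ 2 / 4
       - \sum_x \sum_y (e x y)%:R * v x * v y.

Local Notation a x y := ((e x y)%:R : R).
Local Definition far (p x : V) := (x != p) && ~~ e p x.

Lemma sum_around (p : V) (F : V -> R) :
  \sum_x F x = F p + \sum_(x | e p x) F x + \sum_(x | far p x) F x.
Proof.
rewrite (bigD1 p) //= (bigID (e p)) /= addrA.
congr (_ + _ + _); apply: eq_bigl => x //.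
by case: eqVneq => [->|] //=; rewrite e_irr.
Qed.

(* Schur complement at [p]: the coefficient of [p] is chosen optimally. *)
Lemma residual_psd (p : V) (u w : V -> R) :
  0 <= 2 * \sum_(x | e p x) u x ^+ 2
       + 2 / 3 * (\sum_(x | e p x) u x) * (\sum_(y | far p y) w y)
       - 2 * \sum_(x | e p x) \sum_(y | far p y) a x y * u x * w y
       + 2 * \sum_(y | far p y) w y ^+ 2
       + 2 / 9 * (\sum_(y | far p y) w y) ^+ 2
       - \sum_(x | far p x) \sum_(y | far p y) a x y * w x * w y.
Proof.
set U := \sum_(x | e p x) u x; set W := \sum_(y | far p y) w y.
set U2 := \sum_(x | e p x) u x ^+ 2; set W2 := \sum_(y | far p y) w y ^+ 2.
set X := \sum_(x | e p x) \sum_(y | far p y) _; set Y := \sum_(x | far p x) _.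
(* The terms in [s] are [9/4 s^2 - (3 U - W) s / 2]; at their minimum the square of [U] cancels. *)
pose s := U / 3 - W / 9.
pose v x := if x == p then s else if e p x then u x else w x.
have vp : v p = s by rewrite /v eqxx.
have vC x : e p x -> v x = u x.
  by rewrite /v; case: eqVneq => [->|_ ->] //; rewrite e_irr.
have vT x : far p x -> v x = w x.
  by rewrite /far /v => /andP[/negbTE-> /negbTE->].
have eT x : far p x -> e p x = false by case/andP => _ /negbTE.
have := psd v; rewrite !(sum_around p) !vp.
have -> : \sum_(x | e p x) v x ^+ 2 = U2 by apply: eq_bigr => x /vC->.
have -> : \sum_(x | far p x) v x ^+ 2 = W2 by apply: eq_bigr => x /vT->.
have -> : \sum_(x | e p x) v x = U by apply: eq_bigr => x /vC->.
have -> : \sum_(x | far p x) v x = W by apply: eq_bigr => x /vT->.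
have -> : \sum_(x | e p x) a p x * s * v x = s * U.
  by rewrite mulr_sumr; apply: eq_bigr => x epx; rewrite epx mul1r vC.
have -> : \sum_(x | far p x) a p x * s * v x = 0.
  by rewrite big1 // => x /eT->; rewrite !mul0r.
have -> : \sum_(x | e p x) \sum_y a x y * v x * v y = s * U + X.
  rewrite /X mulr_sumr -big_split; apply: eq_bigr => x epx /=.
  rewrite (sum_around p) vp (e_sym x p) epx mul1r vC // big1 ?addr0 => [|y epy].
    rewrite mulrC; congr (_ + _); apply: eq_bigr => y Ty.
    by rewrite vT.
  by rewrite (@e_tf x p y) ?mul0r // e_sym.
have -> : \sum_(x | far p x) \sum_y a x y * v x * v y = X + Y.
  rewrite [X in _ = X + _]exchange_big /Y -big_split; apply: eq_bigr => x Tx /=.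
  rewrite (sum_around p) vp (e_sym x p) (eT x Tx) !mul0r add0r vT //.
  congr (_ + _); apply: eq_bigr => y hy; last by rewrite vT.
  by rewrite vC // e_sym; ring.
rewrite -/U -/W -/U2 -/W2 e_irr !mul0r /s.
lra.
Qed.

(** * Degree counts and test vectors around a vertex *)

Let deg x : R := \sum_y a x y.
(** [deg2 x] counts the walks of length two from [x], and [total] is twice the number of edges. *)
Let deg2 x : R := \sum_y a x y * deg y.
Let total : R := \sum_x deg x.
Let codeg p w : R := \sum_(z | e p z) a z w.
Let fardeg p w : R := \sum_(y | far p y) a w y.

Lemma sum_nbr p (F : V -> R) : \sum_(x | e p x) F x = \sum_x a p x * F x.
Proof.
by rewrite big_mkcond; apply: eq_bigr => x _; case: (e p x); rewrite ?mul1r ?mul0r.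
Qed.

Lemma sum_nbr_const p (b : R) : \sum_(x | e p x) b = b * deg p.
Proof. by rewrite sum_nbr -mulr_suml mulrC. Qed.

Lemma sum_far_const p (b : R) :
  \sum_(x | far p x) b = b * (#|V|%:R - 1 - deg p).
Proof.
have h : b * #|V|%:R = b + b * deg p + \sum_(x | far p x) b.
  by rewrite -sum_nbr_const -(sum_around p (fun=> b)) sumr_const mulr_natr.
by rewrite !mulrBr h; ring.
Qed.

Lemma deg_nbr p z : e p z -> deg z = 1 + fardeg p z.
Proof.
move=> epz; rewrite /deg (sum_around p) (e_sym z) epz big1 ?addr0 // => y epy.
by rewrite (@e_tf z p y) // e_sym.
Qed.

Lemma deg_far p w : far p w -> deg w = codeg p w + fardeg p w.
Proof.
case/andP=> _ /negbTE npw; rewrite /deg (sum_around p) (e_sym w) npw add0r.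
by congr (_ + _); apply: eq_bigr => y _; rewrite e_sym.
Qed.

Lemma deg2E p : deg2 p = \sum_(z | e p z) deg z.
Proof. by rewrite sum_nbr. Qed.

(** Both sides count the edges between N(p) and the far vertices: a neighbour of [p] has no
    neighbour in N(p), so all its neighbours but [p] are far. *)
Lemma sum_codeg p : \sum_(w | far p w) codeg p w = deg2 p - deg p.
Proof.
rewrite exchange_big /= deg2E -[deg p]mul1r -sum_nbr_const -sumrB.
by apply: eq_bigr => z /deg_nbr ->; rewrite addrC addKr.
Qed.

Lemma sum_fardeg p : \sum_(w | far p w) fardeg p w = total - 2 * deg2 p.
Proof.
have h : \sum_(w | far p w) deg w =
    \sum_(w | far p w) codeg p w + \sum_(w | far p w) fardeg p w.
  by rewrite -big_split; apply: eq_bigr => w /deg_far.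
have := sum_around p deg; rewrite -/total -deg2E h sum_codeg => ->; ring.
Qed.

(** The test vector is [- xi] on N(p) and 1 on the far vertices; [xi] stays free, to be tuned for
    each degree. *)
Lemma star_bound p xi t : t = #|V|%:R - 1 - deg p ->
  total - 2 * deg2 p <=
  2 * t + 2 / 9 * t ^+ 2 - 2 * xi * (deg p * t / 3 - (deg2 p - deg p))
  + 2 * deg p * xi ^+ 2.
Proof.
move=> ->; have := residual_psd p (fun=> - xi) (fun=> 1).
rewrite !sum_nbr_const !sum_far_const.
have -> : \sum_(x | e p x) \sum_(y | far p y) a x y * - xi * 1
    = - xi * (deg2 p - deg p).
  rewrite -sum_codeg exchange_big /= mulr_sumr; apply: eq_bigr => y _.
  by rewrite mulr_sumr; apply: eq_bigr => x _; ring.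
have -> : \sum_(x | far p x) \sum_(y | far p y) a x y * 1 * 1
    = total - 2 * deg2 p.
  rewrite -sum_fardeg; apply: eq_bigr => x _.
  by apply: eq_bigr => y _; rewrite !mulr1.
by lra.
Qed.

Lemma weighted_star_bound p xi (w : V -> R) s : s = \sum_(y | far p y) w y ->
  \sum_(x | far p x) \sum_(y | far p y) a x y * w x * w y <=
  2 * \sum_(y | far p y) w y ^+ 2 + 2 / 9 * s ^+ 2
  - 2 * xi * (deg p * s / 3 - \sum_(y | far p y) codeg p y * w y)
  + 2 * deg p * xi ^+ 2.
Proof.
move=> ->; have := residual_psd p (fun=> - xi) w.
rewrite !sum_nbr_const.
have -> : \sum_(x | e p x) \sum_(y | far p y) a x y * - xi * w y
    = - xi * \sum_(y | far p y) codeg p y * w y.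
  rewrite exchange_big /= mulr_sumr; apply: eq_bigr => y _.
  rewrite /codeg mulr_suml mulr_sumr; apply: eq_bigr => x _; ring.
by lra.
Qed.

(** The far part of the test vector is supported on the two ends of one edge, with weights [al] and
    [be]. *)
Lemma residual_edge p w w' (u : V -> R) (al be : R) :
  far p w -> far p w' -> e w w' ->
  0 <= 2 * \sum_(z | e p z) u z ^+ 2
       + 2 / 3 * (\sum_(z | e p z) u z) * (al + be)
       - 2 * (al * \sum_(z | e p z) a z w * u z
              + be * \sum_(z | e p z) a z w' * u z)
       + 2 * (al ^+ 2 + be ^+ 2) + 2 / 9 * (al + be) ^+ 2 - 2 * al * be.
Proof.
move=> pw pw' eww'.
have w'w : w' != w by apply: contraTneq eww' => ->; rewrite e_irr.
pose v y := al * (y == w)%:R + be * (y == w')%:R.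
have sumv (F : V -> R) : \sum_(y | far p y) F y * v y = al * F w + be * F w'.
  rewrite (bigD1 w) // (bigD1 w') ?pw' //= big1 ?addr0.
    by rewrite /v !eqxx (eq_sym w) (negbTE w'w) /=; ring.
  by move=> y /andP[/andP[_ /negbTE yw] /negbTE yw']; rewrite /v yw yw' /=; ring.
have := residual_psd p u v.
have -> : \sum_(y | far p y) v y = al + be.
  rewrite (eq_bigr (fun y => 1 * v y)) => [|y _]; last by rewrite mul1r.
  by rewrite (sumv (fun=> 1)) !mulr1.
have -> : \sum_(y | far p y) v y ^+ 2 = al ^+ 2 + be ^+ 2.
  rewrite (eq_bigr (fun y => v y * v y)) // sumv /v !eqxx (eq_sym w) (negbTE w'w) /=.
  by ring.
have -> : \sum_(z | e p z) \sum_(y | far p y) a z y * u z * v y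
    = al * \sum_(z | e p z) a z w * u z + be * \sum_(z | e p z) a z w' * u z.
  rewrite !mulr_sumr -big_split; apply: eq_bigr => z _.
  by rewrite (sumv (fun y => a z y * u z)).
have -> : \sum_(x | far p x) \sum_(y | far p y) a x y * v x * v y
    = 2 * al * be.
  rewrite (eq_bigr (fun x => (al * a x w + be * a x w') * v x)); last first.
    by move=> x _; rewrite (sumv (fun y => a x y * v x)); ring.
  by rewrite sumv !e_irr eww' e_sym eww' /=; ring.
by lra.
Qed.

(** The three bounds come from the weights (1, 0), (1, -1) and (1, 1). Each time [u] is the
    pointwise minimiser [(al * a z w + be * a z w') / 2 - (al + be) / 6]. As no [z] is adjacent to
    both ends, all sums become linear in the two codegrees. *)
Lemma codeg_edge_le p w w' : far p w -> far p w' -> e w w' ->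
  [/\ 3 * codeg p w <= 40 - deg p, codeg p w + codeg p w' <= 12
    & 4 * deg p - 52 <= 3 * (codeg p w + codeg p w')].
Proof.
move=> pw pw' eww'.
have disj z : a z w * a z w' = 0.
  case ezw: (e z w); rewrite ?mul0r // mul1r (@e_tf z w w') //.
have sqr z x : a z x ^+ 2 = a z x by case: (e z x); rewrite /= ?expr1n ?expr0n.
have res := residual_edge _ _ _ pw pw' eww'.
have sumE (al be b : R) : \sum_(z | e p z) (al * a z w + be * a z w' + b) =
    al * codeg p w + be * codeg p w' + b * deg p.
  by rewrite !big_split -!mulr_sumr /= sum_nbr_const.
split.
- have := res (fun z => 1 / 2 * a z w + 0 * a z w' + - (1 / 6)) 1 0.
  rewrite sumE.
  rewrite (eq_bigr (fun z => 1 / 12 * a z w + 0 * a z w' + 1 / 36)); last first.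
    by move=> z _; have := sqr z w; lra.
  rewrite sumE (eq_bigr (fun z => 1 / 3 * a z w + 0 * a z w' + 0)); last first.
    by move=> z _; have := sqr z w; lra.
  by rewrite sumE; lra.
- have := res (fun z => 1 / 2 * a z w + - (1 / 2) * a z w' + 0) 1 (-1).
  rewrite sumE.
  rewrite (eq_bigr (fun z => 1 / 4 * a z w + 1 / 4 * a z w' + 0)); last first.
    by move=> z _; have := sqr z w; have := sqr z w'; have := disj z; lra.
  rewrite sumE (eq_bigr (fun z => 1 / 2 * a z w + 0 * a z w' + 0)); last first.
    by move=> z _; have := sqr z w; have := disj z; lra.
  rewrite sumE (eq_bigr (fun z => 0 * a z w + - (1 / 2) * a z w' + 0)); last first.
    by move=> z _; have := sqr z w'; have := disj z; lra.
  by rewrite sumE; lra.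
- have := res (fun z => 1 / 2 * a z w + 1 / 2 * a z w' + - (1 / 3)) 1 1.
  rewrite sumE.
  rewrite (eq_bigr (fun z => - (1 / 12) * a z w + - (1 / 12) * a z w' + 1 / 9)); last first.
    by move=> z _; have := sqr z w; have := sqr z w'; have := disj z; lra.
  rewrite sumE (eq_bigr (fun z => 1 / 6 * a z w + 0 * a z w' + 0)); last first.
    by move=> z _; have := sqr z w; have := disj z; lra.
  rewrite sumE (eq_bigr (fun z => 0 * a z w + 1 / 6 * a z w' + 0)); last first.
    by move=> z _; have := sqr z w'; have := disj z; lra.
  by rewrite sumE; lra.
Qed.

Lemma fardeg_ge0 p w : 0 <= fardeg p w.
Proof. by apply: sumr_ge0 => y _; apply: ler0n. Qed.

(** Walks of length three from [p] are sorted by their third vertex, which is either [p] again or a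
    far [w]. *)
Lemma sum_nbr_deg2 p :
  \sum_(z | e p z) deg2 z = deg p ^+ 2
  + \sum_(w | far p w) codeg p w ^+ 2 + \sum_(w | far p w) codeg p w * fardeg p w.
Proof.
have -> : \sum_(z | e p z) deg2 z =
    \sum_(z | e p z) (deg p + \sum_(w | far p w) a z w * deg w).
  apply: eq_bigr => z epz; rewrite /deg2 (sum_around p) e_sym epz mul1r.
  by rewrite big1 ?addr0 // => y epy; rewrite (@e_tf z p y) ?mul0r // e_sym.
rewrite big_split sum_nbr_const -expr2 -addrA; congr (_ + _).
rewrite exchange_big -big_split; apply: eq_bigr => w pw /=.
by rewrite -mulr_suml -/(codeg p w) (deg_far pw); ring.
Qed.

(** Twice the left side is the sum of [codeg p w + codeg p y] over ordered pairs of adjacent far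
    vertices, and each such term is at most 12. *)
Lemma sum_codeg_fardeg p :
  \sum_(w | far p w) codeg p w * fardeg p w <= 6 * (total - 2 * deg2 p).
Proof.
pose D := \sum_(w | far p w) \sum_(y | far p y) a w y * (codeg p w + codeg p y).
have DE : D = 2 * \sum_(w | far p w) codeg p w * fardeg p w.
  have -> : D = \sum_(w | far p w) codeg p w * fardeg p w
     + \sum_(w | far p w) \sum_(y | far p y) a w y * codeg p y.
    rewrite -big_split; apply: eq_bigr => w _ /=.
    by rewrite /fardeg mulr_sumr -big_split; apply: eq_bigr => y _ /=; ring.
  rewrite [X in _ + X]exchange_big /= mulrDl !mul1r; congr (_ + _).
  apply: eq_bigr => w _; rewrite /fardeg mulr_sumr; apply: eq_bigr => y _.
  by rewrite e_sym mulrC.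
suff : D <= 12 * (total - 2 * deg2 p) by rewrite DE; lra.
rewrite -sum_fardeg mulr_sumr /D; apply: ler_sum => w pw.
rewrite [X in _ <= X]mulr_sumr; apply: ler_sum => y py.
case ewy: (e w y); last by rewrite !mul0r mulr0.
by rewrite mul1r mulr1; have [] := codeg_edge_le pw py ewy.
Qed.

Lemma codeg_sqr_bound p xi (t := #|V|%:R - 1 - deg p)
    (kap := (40 - deg p) / 3) (E := deg2 p - deg p)
    (Q := \sum_(w | far p w) codeg p w ^+ 2) :
  0 <= 2 * (kap ^+ 2 * t - 2 * kap * E + Q) + 2 / 9 * (kap * t - E) ^+ 2
       - 2 * xi * (deg p * (kap * t - E) / 3 - (kap * E - Q))
       + 2 * deg p * xi ^+ 2.
Proof.
have V1 : kap * t - E = \sum_(w | far p w) (kap - codeg p w).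
  by rewrite sumrB sum_far_const sum_codeg.
have := weighted_star_bound xi V1.
have -> : \sum_(w | far p w) (kap - codeg p w) ^+ 2
    = kap ^+ 2 * t - 2 * kap * E + Q.
  rewrite -sum_far_const /E -sum_codeg mulr_sumr -sumrB -big_split.
  by apply: eq_bigr => w _ /=; ring.
have -> : \sum_(w | far p w) codeg p w * (kap - codeg p w) = kap * E - Q.
  rewrite /E -sum_codeg mulr_sumr -sumrB; apply: eq_bigr => w _ /=; ring.
apply: le_trans; apply: sumr_ge0 => x px; apply: sumr_ge0 => y py.
case exy: (e x y); last by rewrite !mul0r.
have [kx _ _] := codeg_edge_le px py exy.
have [ky _ _] := codeg_edge_le py px (etrans (e_sym y x) exy).
by rewrite mul1r mulr_ge0 // /kap; lra.
Qed.

(* [star_bound] summed over the neighbours [z] of [p]. The bound is concave in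
   [deg z], hence replaced by its chord over [1 <= deg z <= c]. *)
Lemma sum_star_bound p xi (N := #|V|%:R - 1 : R) (c := deg p) :
    0 <= xi -> (forall x, deg x <= c) ->
  c * total
  + 2 * c * (xi * c * (1 + (N - c) / 3) - (N - c) - (N - c) ^+ 2 / 9 - c * xi ^+ 2)
  - 2 * (xi + xi * N / 3 + 1 + 2 * N / 9 - xi ^+ 2 - (xi / 3 + 1 / 9) * (c + 1))
    * (c ^+ 2 - deg2 p)
  <= (2 + 2 * xi) * \sum_(z | e p z) deg2 z.
Proof.
move=> xi_ge0 le_c.
set hc := xi * c * _ - _ - _ - _; set sg := xi + _ + _ + _ - _ - _.
have -> : c * total + 2 * c * hc - 2 * sg * (c ^+ 2 - deg2 p)
    = \sum_(z | e p z) (total + 2 * hc - 2 * sg * c + 2 * sg * deg z).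
  by rewrite big_split -mulr_sumr -deg2E /= sum_nbr_const -/c; ring.
rewrite [X in _ <= X]mulr_sumr; apply: ler_sum => z epz.
have := @star_bound z xi _ erefl; rewrite -/N.
have dz : 1 <= deg z by rewrite (deg_nbr epz) lerDl fardeg_ge0.
(* This is the excess of the concave bound over its chord. *)
have : 0 <= (2 * xi / 3 + 2 / 9) * ((deg z - 1) * (c - deg z)).
  by rewrite !mulr_ge0 ?subr_ge0 //; lra.
rewrite /hc /sg; lra.
Qed.

(* [E] counts the edges from N(p) to the far vertices, [G] is twice the number
   of edges between far vertices, [Q] the sum of the squared codegrees with [p]. *)
Lemma star_system p (c t : R) :
    deg p = c -> #|V|%:R = 1 + c + t -> (forall x, deg x <= deg p) ->
  exists E G Q : R,
  [/\ 0 <= E, 0 <= G, E <= c * (c - 1) & G = total - 2 * deg2 p] /\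
  [/\ forall xi, G <= 2 * t + 2 / 9 * t ^+ 2 - 2 * xi * (c * t / 3 - E)
                      + 2 * c * xi ^+ 2,
      forall xi kap, kap = (40 - c) / 3 ->
        0 <= 2 * (kap ^+ 2 * t - 2 * kap * E + Q) + 2 / 9 * (kap * t - E) ^+ 2
             - 2 * xi * (c * (kap * t - E) / 3 - (kap * E - Q)) + 2 * c * xi ^+ 2
    & forall xi N, N = c + t -> 0 <= xi ->
        c * (G + 2 * (E + c))
        + 2 * c * (xi * c * (1 + t / 3) - t - t ^+ 2 / 9 - c * xi ^+ 2)
        - 2 * (xi + xi * N / 3 + 1 + 2 * N / 9 - xi ^+ 2
               - (xi / 3 + 1 / 9) * (c + 1)) * (c * (c - 1) - E)
        <= (2 + 2 * xi) * (c ^+ 2 + Q + 6 * G)].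
Proof.
move=> dp cV dmax.
have tE : t = #|V|%:R - 1 - deg p by rewrite cV dp; ring.
exists (deg2 p - deg p), (total - 2 * deg2 p), (\sum_(w | far p w) codeg p w ^+ 2).
split; split=> //.
- rewrite -sum_codeg; apply: sumr_ge0 => w _; apply: sumr_ge0 => z _.
  exact: ler0n.
- by rewrite -sum_fardeg; apply: sumr_ge0 => w _; apply: fardeg_ge0.
- rewrite mulrBr mulr1 -dp lerB // deg2E -sum_nbr_const.
  by apply: ler_sum => z _; apply: dmax.
- by move=> xi; rewrite -dp; apply: star_bound.
- by move=> xi _ ->; have := codeg_sqr_bound p xi; rewrite -tE dp.
- move=> xi _ -> xi0; have := sum_star_bound xi0 dmax.
  have := ler_wpM2l (_ : 0 <= 2 + 2 * xi) (sum_codeg_fardeg p).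
  rewrite sum_nbr_deg2 cV dp => /(_ ltac:(lra)); lra.
Qed.

(** For [E = c * (c - 1)] the best [xi] is [(t / 3 - c + 1) / 2]. It is nonnegative, so [E] may be
    replaced by this upper bound, and then [G] would be negative. *)
Lemma sparse_star_absurd p (c t : R) :
    deg p = c -> #|V|%:R = 1 + c + t -> (forall x, deg x <= deg p) ->
    0 < c -> 3 * (c - 1) <= t -> 4 * t + 4 / 9 * t ^+ 2 < c * (t / 3 - c + 1) ^+ 2 ->
  False.
Proof.
move=> dp cV dmax c_gt0 tc tlt.
have [E [G [Q [[_ G0 Ec _] [/(_ ((t / 3 - c + 1) / 2)) H _ _]]]]] :=
  star_system dp cV dmax.
have : 0 <= (t / 3 - c + 1) * (c * (c - 1) - E) by rewrite mulr_ge0 //; lra.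
by lra.
Qed.

(* The triples are numerically near-optimal choices of [xi] in the three
   families of [star_system]; [E] enters [H2] quadratically, and [E2] bounds
   [E ^+ 2] by a chord. *)
Lemma dense_star_absurd p (c t x1 x2 x3 : R) :
    deg p = c -> #|V|%:R = 1 + c + t -> (forall x, deg x <= deg p) ->
    [\/ (c, t, (x1, x2, x3)) = (14, 87, (8, 59 / 4, 8)),
        (c, t, (x1, x2, x3)) = (15, 87, (15 / 2, 59 / 4, 29 / 4)),
        (c, t, (x1, x2, x3)) = (16, 86, (27 / 4, 59 / 4, 27 / 4))
      | (c, t, (x1, x2, x3)) = (17, 86, (25 / 4, 59 / 4, 25 / 4))] \/
    [\/ (c, t, (x1, x2, x3)) = (18, 86, (23 / 4, 59 / 4, 11 / 2)),
        (c, t, (x1, x2, x3)) = (19, 85, (21 / 4, 59 / 4, 5))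
      | (c, t, (x1, x2, x3)) = (20, 85, (19 / 4, 59 / 4, 9 / 2))] \/
    (c, t, (x1, x2, x3)) = (21, 85, (17 / 4, 19 / 2, 4)) \/
    (c, t, (x1, x2, x3)) = (22, 84, (7 / 2, 4, 13 / 4)) ->
  False.
Proof.
move=> dp cV dmax params.
have [E [G [Q [[E0 G0 Ec _] [H1 H2 H3]]]]] := star_system dp cV dmax.
have x30 : 0 <= x3 by case: params => [[]|[[]|[]]] [_ _ _ _ ->]; lra.
(* The lower end of the chord is the bound on [E] that [H1] at [xi = 6] gives together with
   [0 <= G]. *)
have E2 : 0 <= (E - (c * t / 3 - (t + t ^+ 2 / 9 + 36 * c) / 6)) * (c * (c - 1) - E).
  by rewrite mulr_ge0 ?subr_ge0 //; have := H1 6; lra.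
move: (H1 x1) (H2 x2 _ erefl) (H3 x3 _ erefl x30) => {}H1 {}H2 {}H3.
clear - params E0 G0 Ec H1 H2 H3 E2.
by case: params => [[]|[[]|[]]] [? ? ? ? ?]; subst; lra.
Qed.

(** * Exclusion of the critical order for every maximum degree *)

Hypothesis indep_le27 : forall I : {set V}, indep e I -> (#|I| <= 27)%N.

Lemma sum_nat_card (B : {set V}) x :
  \sum_(y in B) a x y = #|nbrs e B x|%:R.
Proof.
rewrite -natr_sum -sum1_card big_mkcond [in RHS]big_mkcond /=; congr (_%:R).
by apply: eq_bigr => y _; rewrite inE; case: (y \in B); case: (e x y).
Qed.

Lemma degE x : deg x = #|nbrs e setT x|%:R.
Proof. by rewrite -sum_nat_card; apply: eq_bigl => y; rewrite inE. Qed.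

Lemma total_farE p (B := [set w | far p w]) :
  total - 2 * deg2 p = (\sum_(w in B) #|nbrs e B w|)%:R.
Proof.
rewrite -sum_fardeg natr_sum; apply: eq_big => [w|w _]; first by rewrite inE.
by rewrite -sum_nat_card; apply: eq_bigl => y; rewrite inE.
Qed.

Lemma indep_far_le26 p (I : {set V}) :
  I \subset [set w | far p w] -> indep e I -> (#|I| <= 26)%N.
Proof.
move=> /subsetP IB hI.
have farI x : x \in I -> (x != p) && ~~ e p x by move=> /IB; rewrite inE.
have pI : p \notin I by apply/negP => /farI; rewrite eqxx.
suff /indep_le27 : indep e (p |: I) by rewrite cardsU1 pI.
move=> x y; rewrite !inE => /predU1P[->|xI] /predU1P[->|yI].
- by rewrite e_irr.
- by case/andP: (farI _ yI).
- by rewrite e_sym; case/andP: (farI _ xI).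
- exact: hI.
Qed.

Lemma card_far p : (1 + #|nbrs e setT p| + #|[set w | far p w]| = #|V|)%N.
Proof.
apply/eqP; rewrite -(eqr_nat R) !natrD -degE -sum1_card natr_sum.
rewrite (eq_bigl (far p)) => [|w]; last by rewrite inE.
by rewrite sum_far_const; apply/eqP; ring.
Qed.

(* [1 + c + (276 - c) %/ 3] is the least [m] with [3 * m >= 277 + 2 * c]. *)
Lemma no_critical_graph p (c := #|nbrs e setT p|) :
  (forall x, #|nbrs e setT x| <= c)%N -> #|V| = (1 + c + (276 - c) %/ 3)%N -> False.
Proof.
move=> max_deg cardV.
have dmax x : deg x <= deg p by rewrite !degE ler_nat.
(* N(p) is independent. *)
have c_le : (c <= 27)%N.
  apply: indep_le27 => x y; rewrite !inE /= => px py.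
  by rewrite (@e_tf x p y) // e_sym.
have cardT : #|[set w | far p w]| = ((276 - c) %/ 3)%N.
  by have := card_far p; rewrite -/c cardV; lia.
have dpE : deg p = c%:R by rewrite degE.
have cardVR t : ((276 - c) %/ 3)%N = t -> #|V|%:R = 1 + c%:R + t%:R :> R.
  by move=> <-; rewrite cardV !natrD.
(* Here twice the order is at most [27 * (c + 3)]; the tightest case is [c = 4], with 190 against
   189. *)
have [c_le4 | c_ge5] := leqP c 4.
  have [I [IV hI maxI]] := max_indep_exists e_irr setT.
  have := max_indep_degree_sum e_sym e_irr e_tf IV hI maxI.
  have : (\sum_(x in I) #|nbrs e setT x| <= #|I| * c)%N.
    by rewrite -sum_nat_const; apply: leq_sum => x _.
  have := indep_le27 hI; rewrite cardsT cardV.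
  move: c_le4; clear; case: c => [|[|[|[|[|//]]]]] _ /=; lia.
have [c_le6 | c_ge7] := leqP c 6.
  have t90 : ((276 - c) %/ 3)%N = 90%N by lia.
  (* This gives [G >= 8 * 90 - 16 * 26 = 304], whereas [xi = 12] gives at most 300 for [c = 5] and
     108 for [c = 6]. *)
  have := degree_sum_lower e_sym e_irr e_tf (@indep_far_le26 p).
  rewrite cardT t90 -(ler_nat R) natrD -total_farE.
  have [E [G [Q [[_ _ Ec <-] [/(_ (12 : R)) H _ _]]]]] :=
    star_system dpE (cardVR _ t90) dmax.
  have {c_ge5 c_le6} : c = 5%N \/ c = 6%N by lia.
  by case=> cE; move: Ec H; rewrite cE; lra.
(* The numerical condition of [sparse_star_absurd] still holds at [c = 13], as 3712 < 3757, but
   fails at [c = 14]. *)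
have [c_le13 | c_ge14] := leqP c 13.
  have sparse t : ((276 - c) %/ 3)%N = t -> 3 * (c%:R - 1) <= t%:R :> R ->
      4 * t%:R + 4 / 9 * t%:R ^+ 2 < c%:R * (t%:R / 3 - c%:R + 1) ^+ 2 :> R -> False.
    move=> /cardVR cVt; apply: (sparse_star_absurd dpE cVt dmax).
    by rewrite ltr0n; lia.
  have : c \in iota 7 7 by rewrite mem_iota; lia.
  rewrite !inE => c_cases; move: sparse.
  case/or4P: c_cases => [||| /or4P[]] /eqP-> sparse.
  - by apply: (sparse 89%N) => //; lra.
  - by apply: (sparse 89%N) => //; lra.
  - by apply: (sparse 89%N) => //; lra.
  - by apply: (sparse 88%N) => //; lra.
  - by apply: (sparse 88%N) => //; lra.
  - by apply: (sparse 88%N) => //; lra.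
  - by apply: (sparse 87%N) => //; lra.
have [c_le22 | c_ge23] := leqP c 22.
  have dense t x1 x2 x3 : ((276 - c) %/ 3)%N = t -> _ :=
    fun tE => @dense_star_absurd p _ _ x1 x2 x3 dpE (cardVR t tE) dmax.
  have : c \in iota 14 9 by rewrite mem_iota; lia.
  rewrite !inE => c_cases; move: dense.
  case/or4P: c_cases => [||| /or4P[||| /or3P[]]] /eqP-> dense.
  - by apply: (dense 87%N _ _ _ _ (or_introl (Or41 _ _ _ erefl))).
  - by apply: (dense 87%N _ _ _ _ (or_introl (Or42 _ _ _ erefl))).
  - by apply: (dense 86%N _ _ _ _ (or_introl (Or43 _ _ _ erefl))).
  - by apply: (dense 86%N _ _ _ _ (or_introl (Or44 _ _ _ erefl))).
  - by apply: (dense 86%N _ _ _ _ (or_intror (or_introl (Or31 _ _ erefl)))).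
  - by apply: (dense 85%N _ _ _ _ (or_intror (or_introl (Or32 _ _ erefl)))).
  - by apply: (dense 85%N _ _ _ _ (or_intror (or_introl (Or33 _ _ erefl)))).
  - by apply: (dense 85%N _ _ _ _ (or_intror (or_intror (or_introl erefl)))).
  - by apply: (dense 84%N _ _ _ _ (or_intror (or_intror (or_intror erefl)))).
(* There are at least 83 far vertices. An edge between two of them would force [4 * c - 52 <= 36],
   false from [c = 23] on. *)
suff /(indep_far_le26 (subxx _)) : indep e [set w | far p w].
  by rewrite cardT; lia.
move=> x y; rewrite !inE => px py; apply/negP => exy.
have [_ le12 ge] := codeg_edge_le px py exy.
have : 23 <= deg p by rewrite dpE ler_nat.
by lra.
Qed.

End TriangleFreeGraph.

(** * Seidel matrices *)

(** The matrix is diagonalised unitarily over the complex numbers. Being Hermitian it has real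
    eigenvalues there, and these are eigenvalues of [A] over [R]. *)
Lemma symmetric_form_ge (R : rcfType) (n : nat) (A : 'M[R]_n) (l : R) (x : 'rV[R]_n) :
    A^T = A -> (forall b, eigenvalue A b -> l <= b) ->
  l * (x *m x^T) 0 0 <= (x *m A *m x^T) 0 0.
Proof.
move=> symA min_l.
pose toC := real_complex R; pose B := map_mx toC A.
have conj_toC m1 m2 (M : 'M[R]_(m1, m2)) : map_mx Num.conj (map_mx toC M) = map_mx toC M.
  by apply/matrixP => i j; rewrite !mxE; apply: conjc_real.
have Bt : map_mx Num.conj B^T = B by rewrite /B map_trmx symA conj_toC.
have /orthomx_spectralP : B \is normalmx by apply/normalmxP; rewrite Bt.
set P := spectralmx B; set d := spectral_diag B => BE.
have Pu : P \is unitarymx := spectral_unitarymx B.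
have Punit : P \in unitmx := spectral_unit B.
rewrite (invmx_unitary Pu) in BE.
(* The coordinates of [x] in the orthonormal basis of eigenvectors, the rows of [P]. *)
pose y := map_mx toC x *m (map_mx Num.conj P^T).
have d_ge j : toC l <= d 0 j.
  have : eigenvalue B (d 0 j).
    apply/eigenvalueP; exists (row j P); last first.
      apply/negP => /eqP Pj0; have := row_free_unit P; rewrite Punit.
      by move=> /row_freeP[Q PQ]; have := congr1 (row j) PQ;
         rewrite row_mul Pj0 mul0mx => /rowP/(_ j); rewrite !mxE eqxx => /eqP;
         rewrite eq_sym oner_eq0.
    rewrite -row_mul BE !mulmxA (unitarymxP Pu) mul1mx row_mul row_diag_mx.
    by rewrite -scalemxAl -rowE.
  have /mxOverP/(_ 0 j) : d \is a realmx.
    apply: hermitian_spectral_diag_real; apply/sesquilinear.is_hermitianmxP.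
    by rewrite expr0 scale1r Bt.
  case/complex_realP => b ->; rewrite eigenvalue_map => /min_l.
  by rewrite lecR.
have yt : map_mx Num.conj y^T = P *m map_mx toC x^T.
  rewrite /y trmx_mul map_mxM -[in LHS](map_trmx _ P) trmxK -map_mx_comp.
  by rewrite (map_mx_id (@conjCK _)) map_trmx conj_toC.
have yy : map_mx toC (x *m x^T) = y *m (map_mx Num.conj y^T).
  by rewrite map_mxM yt /y -(invmx_unitary Pu) mulmxA mulmxKV.
have yAy : map_mx toC (x *m A *m x^T) = y *m diag_mx d *m (map_mx Num.conj y^T).
  by rewrite !map_mxM -/B BE yt /y !mulmxA.
suff : toC l * toC ((x *m x^T) 0 0) <= toC ((x *m A *m x^T) 0 0).
  by rewrite -rmorphM lecR.
have -> : toC ((x *m x^T) 0 0) = (y *m (map_mx Num.conj y^T)) 0 0.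
  by rewrite -yy [RHS]mxE.
have -> : toC ((x *m A *m x^T) 0 0) = (y *m diag_mx d *m (map_mx Num.conj y^T)) 0 0.
  by rewrite -yAy [RHS]mxE.
rewrite !mxE mulr_sumr; apply: ler_sum => j _.
rewrite mul_mx_diag !mxE mulrAC mulrC -subr_ge0 -mulrBr.
by rewrite mulr_ge0 ?mul_conjC_ge0 ?subr_ge0.
Qed.

(** * Signed lines and the switching graph *)

Section Seidel.
Variables (R : realType) (n : nat) (S : 'M[R]_n).
Hypothesis S_seidel : is_seidel S.

Lemma seidel_sym i j : S i j = S j i.
Proof. by case: S_seidel => symS _ _; rewrite -{1}symS mxE. Qed.

Lemma seidel_diag i : S i i = 0.
Proof. by case: S_seidel. Qed.

Lemma seidel_off i j : i != j -> S i j = 1 \/ S i j = -1.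
Proof. by case: S_seidel => _ _; apply. Qed.

Lemma neg1_neq1 : (-1 == 1 :> R) = false.
Proof. by apply/negbTE; rewrite eq_sym -subr_eq0 opprK paddr_eq0 ?oner_eq0. Qed.

(* The vertex of the switching graph standing for the [k]-th line with sign [r]. *)
Definition vertex (k : 'I_n) (r : R) : 'I_(n + n) :=
  if r == 1 then lshift n k else rshift n k.

Lemma vertexE k l (r s : R) : k != l -> r = 1 \/ r = -1 -> s = 1 \/ s = -1 ->
  switching_seidel S (vertex k r) (vertex l s) = r * s * S k l.
Proof.
move=> kl; rewrite /vertex /switching_seidel.
by case=> -> [->|->]; rewrite ?eqxx ?neg1_neq1 ?block_mxEul ?block_mxEur
  ?block_mxEdl ?block_mxEdr ?mxE ?(negbTE kl) ?mulr0n /=; ring.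
Qed.

Lemma vertex_inj k l r s : vertex k r = vertex l s -> k = l.
Proof.
rewrite /vertex; case: ifP => _; case: ifP => _.
- exact: lshift_inj.
- by move/eqP; rewrite eq_lrshift.
- by move/eqP; rewrite eq_rlshift.
- exact: rshift_inj.
Qed.

Lemma signed_clique (K : {set 'I_n}) (s : 'I_n -> R) :
    {in K, forall k, s k = 1 \/ s k = -1} ->
    {in K &, forall k l, k != l -> s k * s l * S k l = -1} ->
  (#|K| <= switching_omega S)%N.
Proof.
move=> hs hK; pose f k := vertex k (s k).
have f_inj : injective f by move=> k l; apply: vertex_inj.
rewrite -(card_imset _ f_inj); apply: leq_bigmax_cond.
apply/forallP => x; apply/implyP => /imsetP[k kK ->].
apply/forallP => y; apply/implyP => /imsetP[l lK ->].
rewrite (inj_eq f_inj); apply/implyP => kl.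
by rewrite /switching_graph /seidel_graph vertexE ?hK //; apply: hs.
Qed.

Lemma signed_independent (K : {set 'I_n}) (s : 'I_n -> R) :
    {in K, forall k, s k = 1 \/ s k = -1} ->
    {in K &, forall k l, k != l -> s k * s l * S k l = 1} ->
  (#|K| <= switching_alpha S)%N.
Proof.
move=> hs hK; pose f k := vertex k (s k).
have f_inj : injective f by move=> k l; apply: vertex_inj.
rewrite -(card_imset _ f_inj); apply: leq_bigmax_cond.
apply/forallP => x; apply/implyP => /imsetP[k kK ->].
apply/forallP => y; apply/implyP => /imsetP[l lK ->].
rewrite (inj_eq f_inj); apply/implyP => kl.
rewrite /switching_graph /seidel_graph vertexE ?hK //; try exact: hs.
by rewrite eq_sym neg1_neq1.
Qed.

(** The triples of the two-graph of [S]: changing the sign of a line changes two factors, so the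
    product is invariant under switching. *)
Definition negative i j k := S i j * S j k * S i k == -1.

Lemma negative_neq i j k : negative i j k -> [/\ i != j, j != k & i != k].
Proof.
rewrite /negative => h; split; apply: contraTneq h => ->;
  by rewrite seidel_diag ?mul0r ?mulr0 ?mul0r eq_sym oppr_eq0 oner_eq0.
Qed.

Lemma negative_swap i j k : negative i j k = negative i k j.
Proof. by rewrite /negative (seidel_sym k j); congr (_ == _); ring. Qed.

Lemma negative_rot i j k : negative i j k = negative j k i.
Proof.
by rewrite /negative (seidel_sym k i) (seidel_sym j i); congr (_ == _); ring.
Qed.

Lemma negativeN i j k : i != j -> j != k -> i != k ->
  negative i j k = false -> S i j * S j k * S i k = 1.
Proof.
move=> /seidel_off + /seidel_off + /seidel_off; rewrite /negative.
by case=> ->; case=> ->; case=> -> /eqP; lra.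
Qed.

(** Giving each [k] in [K] the sign [- S i k] makes its product with [i] equal to -1, and that of
    [k] and [l] equal to the product over the triple [i], [k], [l]. Thus [i] joins the clique. *)
Lemma negative_clique i (K : {set 'I_n}) :
    i \notin K -> {in K &, forall k l, k != l -> negative i k l} ->
  (#|K| < switching_omega S)%N.
Proof.
move=> iK hK; pose s k := if k == i then 1 else - S i k.
have neq k : k \in K -> (k == i) = false.
  by move=> kK; apply/negbTE; apply: contraNneq iK => <-.
have sqr k : k \in K -> S i k * S i k = 1.
  move=> /neq ki; have ik : i != k by rewrite eq_sym ki.
  by case: (seidel_off ik) => ->; ring.
suff: (#|i |: K| <= switching_omega S)%N by rewrite cardsU1 iK add1n.
apply: (@signed_clique _ s) => [k | k l]; rewrite !inE /s.
  case/predU1P => [->|kK]; first by rewrite eqxx; left.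
  rewrite neq //; have ik : i != k by rewrite eq_sym neq.
  by case: (seidel_off ik) => ->; rewrite ?opprK; [right | left].
case/predU1P => [->|kK] /predU1P[->|lK]; rewrite ?eqxx ?neq //.
- by move=> _; have := sqr l lK; lra.
- by move=> _; have := sqr k kK; rewrite (seidel_sym k i); lra.
- by move=> /(hK k l kK lK)/eqP; lra.
Qed.

Lemma negative_independent i (K : {set 'I_n}) :
    i \notin K -> {in K &, forall k l, negative i k l = false} ->
  (#|K| < switching_alpha S)%N.
Proof.
move=> iK hK; pose s k := if k == i then -1 else - S i k.
have neq k : k \in K -> (k == i) = false.
  by move=> kK; apply/negbTE; apply: contraNneq iK => <-.
have sqr k : k \in K -> S i k * S i k = 1.
  move=> /neq ki; have ik : i != k by rewrite eq_sym ki.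
  by case: (seidel_off ik) => ->; ring.
suff: (#|i |: K| <= switching_alpha S)%N by rewrite cardsU1 iK add1n.
apply: (@signed_independent _ s) => [k | k l]; rewrite !inE /s.
  case/predU1P => [->|kK]; first by rewrite eqxx; right.
  rewrite neq //; have ik : i != k by rewrite eq_sym neq.
  by case: (seidel_off ik) => ->; rewrite ?opprK; [right | left].
case/predU1P => [->|kK] /predU1P[->|lK]; rewrite ?eqxx ?neq //.
- by move=> _; have := sqr l lK; lra.
- by move=> _; have := sqr k kK; rewrite (seidel_sym k i); lra.
- move=> kl; have := hK k l kK lK => /negativeN h.
  by have := h _ kl _; rewrite !(eq_sym i) !neq // => /(_ isT isT); lra.
Qed.

(** * Links of pairs of lines *)

Definition link i j := [set w | negative i j w].

(** Each entry among four lines lies in two of their four triples, so an even number of these is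
    negative. Hence a further [v] is in one or three of the links, while [i], [j] and [w] are in one
    each. *)
Lemma card_links i j w : negative i j w ->
  (#|link i j| + #|link i w| + #|link j w| =
   n + 2 * #|[set v in link i j | negative i w v]|)%N.
Proof.
move=> ijw; have [ij jw iw] := negative_neq ijw.
have cardE (P : pred 'I_n) : #|[set v | P v]| = (\sum_v P v)%N.
  by rewrite -sum1_card big_mkcond; apply: eq_bigr => v _; rewrite inE; case: (P v).
have cardn : n = (\sum_(v < n) 1)%N by rewrite sum1_card card_ord.
rewrite !cardE [X in _ = (X + _)%N]cardn big_distrr -!big_split /=.
apply: eq_bigr => v _; rewrite inE.
have ww u x : negative u x x = false.
  by apply/negP => /negative_neq[]; rewrite eqxx.
have uu u x : negative u x u = false.
  by apply/negP => /negative_neq[]; rewrite eqxx.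
have [->|vi] := eqVneq v i; first by rewrite !uu -negative_rot ijw.
have [->|vj] := eqVneq v j; first by rewrite !ww uu -negative_swap ijw.
have [->|vw] := eqVneq v w; first by rewrite !ww ijw.
move: ijw; rewrite /negative (seidel_sym w v) (seidel_sym j v) (seidel_sym i v).
move: (seidel_off ij) (seidel_off jw) (seidel_off iw).
move: (seidel_off vi) (seidel_off vj) (seidel_off vw).
by do 6 (case=> ->); rewrite ?(mulr1, mul1r, mulrN1, mulN1r, opprK) ?eqxx
  ?neg1_neq1 // 1?eq_sym ?neg1_neq1.
Qed.

Hypothesis S_psd : forall x : 'I_n -> R,
  0 <= \sum_k \sum_l S k l * x k * x l + 5 * \sum_k x k ^+ 2.

Lemma sum_delta (F : 'I_n -> R) i : \sum_k F k * (k == i)%:R = F i.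
Proof.
rewrite (bigD1 i) //= eqxx mulr1 big1 ?addr0 // => k /negbTE->.
by rewrite mulr0.
Qed.

Lemma link_psd i j (B : {set 'I_n}) (v : 'I_n -> R) :
    i != j -> B \subset link i j ->
  0 <= 2 * \sum_(x in B) v x ^+ 2 + (\sum_(x in B) v x) ^+ 2 / 4
       - \sum_(x in B) \sum_(y in B) (negative i x y)%:R * v x * v y.
Proof.
move=> ij /subsetP BL; set V1 := \sum_(x in B) v x.
set V2 := \sum_(x in B) v x ^+ 2.
set A := \sum_(x in B) \sum_(y in B) _.
pose u k := if k \in B then - S i k * v k else 0.
(* The sign of [g] gives the signed line [j] product -1 with [i] and with the signed link. The terms
   in [h] are then [8 h^2 - 4 h V1], least at [V1 / 4]. *)
pose h := V1 / 4; pose g := - S i j * h.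
pose x k := u k + (h * (k == i)%:R + g * (k == j)%:R).
have link_neq k : k \in B -> [/\ i != j, j != k & i != k].
  by move=> /BL; rewrite inE => /negative_neq.
have uE (F : 'I_n -> R) : \sum_k F k * u k = \sum_(k in B) F k * (- S i k * v k).
  rewrite [RHS]big_mkcond; apply: eq_bigr => k _; rewrite /u.
  by case: ifP; rewrite ?mulr0.
have xE (F : 'I_n -> R) : \sum_k F k * x k = \sum_k F k * u k + (h * F i + g * F j).
  rewrite -(sum_delta F i) -(sum_delta F j) !mulr_sumr -!big_split.
  by apply: eq_bigr => k _ /=; rewrite /x; ring.
have sqr k l : k != l -> S k l * S k l = 1.
  by move=> /seidel_off[] ->; ring.
have ui : u i = 0.
  by rewrite /u; case: ifP => // /link_neq[]; rewrite eqxx.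
have uj : u j = 0.
  by rewrite /u; case: ifP => // /link_neq[]; rewrite eqxx.
have xi : x i = h by rewrite /x ui eqxx (negbTE ij) /=; ring.
have xj : x j = g by rewrite /x uj eqxx (eq_sym j) (negbTE ij) /=; ring.
pose r k := \sum_l S k l * u l.
have ri : r i = - V1.
  rewrite /r uE -sumrN; apply: eq_bigr => k /link_neq[_ _ ik].
  by have := sqr _ _ ik; move: (S i k) (v k) => s w sq; rewrite mulrA mulrN sq; ring.
have rj : - S i j * r j = - V1.
  rewrite /r uE -sumrN mulr_sumr; apply: eq_bigr => k /BL; rewrite inE => /eqP.
  rewrite /negative; move: (S i j) (S j k) (S i k) (v k) => s1 s2 s3 w e.
  by transitivity (s1 * s2 * s3 * w); [ring | rewrite e; ring].
have uu : \sum_k u k * r k = V1 ^+ 2 - V2 - 2 * A.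
  have -> : \sum_k u k * r k = \sum_(k in B) \sum_(l in B)
      (v k * v l - (k == l)%:R * (v k * v l) - 2 * ((negative i k l)%:R * v k * v l)).
    under eq_bigr do rewrite mulrC.
    rewrite uE; apply: eq_bigr => k kB; rewrite /r uE mulr_suml.
    apply: eq_bigr => l lB; have [_ _ ik] := link_neq k kB.
    have [_ _ il] := link_neq l lB; have [<-|kl] := eqVneq k l.
      have -> : negative i k k = false by apply/negP => /negative_neq[]; rewrite eqxx.
      by rewrite seidel_diag /=; ring.
    have -> : S k l * (- S i l * v l) * (- S i k * v k)
        = S i k * S k l * S i l * (v k * v l) by ring.
    case ikl : (negative i k l); first by rewrite (eqP ikl) /=; ring.
    by rewrite (negativeN ik kl il ikl) /=; ring.
  under eq_bigr do rewrite 2!sumrB.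
  rewrite 2!sumrB /A; congr (_ - _ - _).
  - by rewrite expr2 mulr_suml; apply: eq_bigr => k _; rewrite mulr_sumr.
  - apply: eq_bigr => k kB; rewrite (bigD1 k) //= eqxx big1 ?addr0 => [|l].
      by rewrite mul1r expr2.
    by rewrite eq_sym => /andP[_ /negbTE->]; rewrite mul0r.
  - by rewrite mulr_sumr; apply: eq_bigr => k _; rewrite mulr_sumr.
have := S_psd x.
have -> : \sum_k x k ^+ 2 = V2 + 2 * h ^+ 2.
  under eq_bigr do rewrite expr2.
  rewrite xE xi xj; under eq_bigr do rewrite mulrC.
  rewrite xE ui uj.
  have -> : \sum_k u k * u k = V2.
    rewrite uE; apply: eq_bigr => k kB; have [_ _ ik] := link_neq k kB.
    by rewrite /u kB; have := sqr _ _ ik => sq; transitivity (S i k * S i k * v k ^+ 2);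
      [ring | rewrite sq mul1r].
  have := sqr _ _ ij; rewrite /g => sq.
  by transitivity (V2 + (1 + S i j * S i j) * h ^+ 2); [ring | rewrite sq; ring].
have -> : \sum_k \sum_l S k l * x k * x l
    = V1 ^+ 2 - V2 - 2 * A - 4 * h * V1 - 2 * h ^+ 2.
  have -> : \sum_k \sum_l S k l * x k * x l
      = \sum_k (r k + (h * S k i + g * S k j)) * x k.
    apply: eq_bigr => k _; rewrite -xE mulr_suml; apply: eq_bigr => l _; ring.
  rewrite xE !seidel_diag (seidel_sym j i).
  have -> : \sum_k (r k + (h * S k i + g * S k j)) * u k
      = \sum_k u k * r k + (h * r i + g * r j).
    rewrite /r !mulr_sumr -!big_split; apply: eq_bigr => k _ /=.
    by rewrite (seidel_sym k i) (seidel_sym k j); ring.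
  rewrite uu ri; have := sqr _ _ ij; rewrite /g => sq.
  transitivity (V1 ^+ 2 - V2 - 2 * A - 2 * h * V1 + 2 * h * (- S i j * r j)
    - 2 * (S i j * S i j) * h ^+ 2); first by ring.
  by rewrite rj sq; ring.
rewrite /h; lra.
Qed.

End Seidel.

(** Serves to shrink a link to the critical order while keeping [p] and all its neighbours. *)
Lemma subset_of_card (T : finType) (A B : {set T}) (k : nat) :
    A \subset B -> (#|A| <= k <= #|B|)%N ->
  exists C : {set T}, [/\ A \subset C, C \subset B & #|C| = k].
Proof.
move=> AB /andP[Ak kB].
have DB : (k - #|A| <= #|B :\: A|)%N by rewrite cardsDS // leq_sub2r.
pose D := [set x in take (k - #|A|) (enum (B :\: A))].
have DBA x : x \in D -> x \in B :\: A by rewrite inE => /mem_take; rewrite mem_enum.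
have cardD : #|D| = (k - #|A|)%N.
  rewrite cardsE (card_uniqP _) ?take_uniq ?enum_uniq // size_takel //.
  by rewrite -cardE.
exists (A :|: D); split; first exact: subsetUl.
  by rewrite subUset AB; apply/subsetP => x /DBA; rewrite inE => /andP[].
rewrite cardsU cardD (_ : A :&: D = set0) ?cards0 ?subn0 ?subnKC //.
apply/setP => x; rewrite in_set0 in_setI; apply/negP => /andP[xA /DBA].
by rewrite inE xA.
Qed.

(** * Passage to the largest link *)

Unset Implicit Arguments.

Theorem theorem9p3 (R : realType) (n : nat) (S : 'M[R]_n)
    (S_seidel : is_seidel S)
    (S_min : is_smallest_eigenvalue S (-5%:R))
    (S_omega : switching_omega S = 4%N)
    (S_alpha : (switching_alpha S <= 28)%N) :
  (n <= 276)%N.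
Proof.
have S_psd (x : 'I_n -> R) :
    0 <= \sum_k \sum_l S k l * x k * x l + 5 * \sum_k x k ^+ 2.
  case: S_min => _ min5; case: (S_seidel) => symS _ _.
  have := symmetric_form_ge (\row_k x k) symS min5.
  have -> : ((\row_k x k) *m (\row_k x k)^T) 0 0 = \sum_k x k ^+ 2.
    by rewrite mxE; apply: eq_bigr => k _; rewrite !mxE expr2.
  have -> : ((\row_k x k) *m S *m (\row_k x k)^T) 0 0 = \sum_k \sum_l S k l * x k * x l.
    rewrite mxE exchange_big; apply: eq_bigr => l _ /=.
    rewrite !mxE mulr_suml; apply: eq_bigr => k _; rewrite !mxE; ring.
  by lra.
rewrite leqNgt; apply/negP => n_gt.
have negative_irr u w : negative S u w w = false.
  by apply/negP => /(negative_neq S_seidel)[]; rewrite eqxx.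
have i0 : 'I_n by apply: (@Ordinal n 0); lia.
pose D (ij : 'I_n * 'I_n) := #|link S ij.1 ij.2|.
case: (@arg_maxnP _ (i0, i0) predT D isT) => -[i j] _ maxD.
(* If the largest link were empty, no triple would be negative and all [n] lines would yield an
   independent set, too large for [S_alpha]. *)
have [p0 p0L] : exists p0, p0 \in link S i j.
  have [p0 p0L | noL] := pickP (mem (link S i j)); first by exists p0.
  have link0 : D (i, j) = 0%N by apply: eq_card0.
  have all0 k l : negative S i0 k l = false.
    apply/negP => kl; have : (D (i0, k) <= D (i, j))%N := maxD _ isT.
    by rewrite link0 leqNgt => /negP; apply; apply/card_gt0P; exists l; rewrite inE.
  have := @negative_independent _ _ _ S_seidel i0 [set~ i0] _ _.
  rewrite !inE eqxx cardsC1 card_ord => /(_ isT (fun k l _ _ => all0 k l)).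
  by lia.
have ij : i != j by move: p0L; rewrite inE => /(negative_neq S_seidel)[].
pose c w := #|[set v in link S i j | negative S i w v]|.
case: (@arg_maxnP _ p0 (mem (link S i j)) c p0L) => p pL maxc.
have card_le : (n + 2 * c p <= 3 * #|link S i j|)%N.
  have ijp : negative S i j p by rewrite /= inE in pL.
  rewrite -(card_links S_seidel ijp).
  have : (D (i, p) <= D (i, j))%N := maxD _ isT.
  have : (D (j, p) <= D (i, j))%N := maxD _ isT.
  by rewrite /D /=; lia.
pose A := p |: [set v in link S i j | negative S i p v].
have cardA : #|A| = (1 + c p)%N by rewrite cardsU1 inE negative_irr andbF.
have AL : A \subset link S i j.
  apply/subsetP => x; rewrite in_setU1 => /predU1P[->//|].
  by rewrite inE => /andP[].
have cardAL := subset_leq_card AL.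
have [B [AB BL cardB]] := @subset_of_card _ A (link S i j)
  (1 + c p + (276 - c p) %/ 3) AL ltac:(lia).
have pB : p \in B by apply: (subsetP AB); rewrite setU11.
pose V : finType := {x in B}.
pose e : rel V := fun x y => negative S i (val x) (val y).
have valL (x : V) : val x \in link S i j by apply: (subsetP BL); apply: valP.
have e_sym : symmetric e by move=> x y; apply: negative_swap.
have e_irr : irreflexive e by move=> x; apply: negative_irr.
(* A triangle in the link, together with [j] and [i], would give a clique of five vertices. *)
have e_tf x y z : e x y -> e y z -> e x z = false.
  move=> exy eyz; apply/negP => exz.
  have neq (u v : V) : e u v -> val u != val v by move=> /(negative_neq S_seidel)[].
  have jneq (u : V) : j != val u.
    by have := valL u; rewrite inE => /(negative_neq S_seidel)[].
  have ineq (u : V) : i != val u.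
    by have := valL u; rewrite inE => /(negative_neq S_seidel)[].
  have : (#|j |: (val x |: (val y |: [set val z]))| < switching_omega S)%N.
    apply: (negative_clique S_seidel (i := i)).
      by rewrite !inE (negbTE ij) !(negbTE (ineq _)).
    have clique k l : k \in j |: (val x |: (val y |: [set val z])) ->
        l \in j |: (val x |: (val y |: [set val z])) -> k != l -> negative S i k l.
      have ejx (u : V) : negative S i j (val u) by have := valL u; rewrite inE.
      have exj (u : V) : negative S i (val u) j by rewrite (negative_swap S_seidel).
      rewrite !inE => /or4P[] /eqP-> /or4P[] /eqP->; rewrite ?eqxx // => _;
        by rewrite (negative_swap S_seidel).
    by move=> k l; apply: clique.
  rewrite S_omega !cardsU1 !cards1 !inE.
  rewrite !(negbTE (jneq _)) (negbTE (neq _ _ exy)) (negbTE (neq _ _ eyz)).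
  by rewrite (negbTE (neq _ _ exz)).
have sumB (F : 'I_n -> R) : \sum_(x : V) F (val x) = \sum_(k in B) F k.
  exact: esym (big_sub B F).
have psd (v : V -> R) : 0 <= 2 * \sum_x v x ^+ 2 + (\sum_x v x) ^+ 2 / 4
    - \sum_x \sum_y (e x y)%:R * v x * v y.
  pose w k := if insub k is Some x then v x else 0.
  have wE (x : V) : w (val x) = v x by rewrite /w valK.
  have := link_psd S_seidel S_psd w ij BL; rewrite -!sumB.
  under eq_bigr do rewrite wE.
  under [X in X ^+ 2]eq_bigr do rewrite wE.
  under [X in _ - X]eq_bigr => x _.
    rewrite -sumB; under eq_bigr do rewrite !wE.
    over.
  by [].
have card_val (P : pred 'I_n) : #|[set y : V | P (val y)]| = #|[set k in B | P k]|.
  rewrite -(card_imset _ val_inj); apply: eq_card => k; rewrite inE.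
  apply/imsetP/andP => [[y + ->] | [kB Pk]]; first by rewrite inE; split=> //; apply: valP.
  by exists (Sub k kB); rewrite ?inE.
have deg_le (x : V) : (#|nbrs e setT x| <= c (val x))%N.
  have -> : nbrs e setT x = [set y | negative S i (val x) (val y)].
    by apply/setP => y; rewrite !inE.
  rewrite (card_val (negative S i (val x))); apply/subset_leq_card/subsetP => k.
  by rewrite !inE => /andP[/(subsetP BL) + ->]; rewrite inE => ->.
pose pV : V := Sub p pB.
(* No neighbour of [p] was discarded, as [A] lies in [B]. *)
have deg_p : #|nbrs e setT pV| = c p.
  apply/eqP; rewrite eqn_leq deg_le /=.
  have -> : nbrs e setT pV = [set y | negative S i p (val y)].
    by apply/setP => y; rewrite !inE.
  rewrite (card_val (negative S i p)); apply/subset_leq_card/subsetP => k.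
  rewrite !inE => /andP[ijk ipk]; rewrite ipk andbT; apply: (subsetP AB).
  by rewrite !inE ijk ipk orbT.
apply: (no_critical_graph e_sym e_irr e_tf psd _ (p := pV)).
(* The line [i] extends an independent set of the link, so 28 becomes 27. *)
- move=> I hI; rewrite -(card_imset _ val_inj) -ltnS.
  apply: leq_trans (negative_independent S_seidel (i := i) _ _) _ => //.
    apply/imsetP => -[x _ ix]; have := valL x.
    by rewrite -ix inE => /(negative_neq S_seidel)[_ _]; rewrite eqxx.
  move=> _ _ /imsetP[x xI ->] /imsetP[y yI ->].
  exact: negbTE (hI x y xI yI).
- by move=> x; rewrite deg_p (leq_trans (deg_le x)) //; exact: maxc (valL x).
- by rewrite card_sig deg_p -cardB; apply: eq_card.
Qed.
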